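(* Let $a,b\in\mathbb R$, $0\le a<b$, and let $P(x)=(x-a)(b-x)P_1(x)$ with $P_1(x)=\sum_{k=0}^na_kx^k$, $a_k\in\mathbb C$. If the convex hull of the coefficients $a_0,\dots,a_n$ in $\mathbb C$ does not contain $0$, then $P$ has Property (E) (with respect to $a,b$).
   Context: Property (E) for a polynomial $P$ and points $a,b$ with $P(a)=P(b)=z_0$: there is a path $\Gamma\subset\mathbb C$ joining $a$ and $b$ (piecewise-smooth, with $\gamma=P(\Gamma)$ having only transversal self-intersections) such that $z_0$ is a simple point of $\gamma$ (i.e. $\gamma$ passes through $z_0$ only at its beginning and end) and $z_0$ is on the boundary of the unbounded component of $\mathbb C\setminus\gamma$. (Here $z_0=0$.) *)

(* Defs.v *)
(* MathComp / MathComp-Analysis; the complex plane is R[i] for R : realType. *)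
From HB Require Import structures.
From mathcomp Require Export all_boot all_order all_algebra.
From mathcomp Require Export all_classical all_reals all_analysis.
From mathcomp Require Export complex.

Set Implicit Arguments.
Unset Strict Implicit.
Unset Printing Implicit Defensive.

Export Order.TTheory GRing.Theory Num.Theory.
Export numFieldNormedType.Exports.

Local Open Scope ring_scope.
Local Open Scope classical_set_scope.
Local Open Scope complex_scope.

(* The usual topology of the complex plane, given by the modulus. *)
HB.instance Definition _ (R : rcfType) := NormedModule.copy R[i] R[i]^o.

Section PropertyE.
Context {R : realType}.
Local Notation Re := (@complex.Re R).
Local Notation Im := (@complex.Im R).
Implicit Types (f g : R -> R[i]) (s t u v : R) (z : R[i]).

(* Derivability of a complex-valued function of a real variable is expressed
   on its real and imaginary parts, R[i] being a normed module over itself and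
   not over R. *)
Definition cderivable f t :=
  derivable (Re \o f) t 1 /\ derivable (Im \o f) t 1.

Definition velocity f t : R[i] :=
  (Re \o f)^`() t +i* (Im \o f)^`() t.

Definition smooth_at f t :=
  forall k : nat, derivable (Re \o f)^`(k) t 1 /\
                  derivable (Im \o f)^`(k) t 1.

(* Smoothness on the closed interval [u, v], one-sided at the end points, is
   rendered by a smooth function g on an open interval containing [u, v] that
   coincides with f on [u, v].  As usual for smooth curves, the velocity does
   not vanish. *)
Definition smooth_arc f u v :=
  exists g, exists2 e : R, 0 < e &
    [/\ forall t, t \in `]u - e, v + e[ -> smooth_at g t,
        forall t, t \in `[u, v] -> g t = f t
      & forall t, t \in `[u, v] -> velocity g t != 0].

Definition piecewise_smooth f u v :=
  exists2 r : seq R, itv_partition u v r &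
    forall k : nat, (k < size r)%N ->
      smooth_arc f (nth 0 (u :: r) k) (nth 0 (u :: r) k.+1).

Definition transversal z1 z2 :=
  Re z1 * Im z2 != Im z1 * Re z2.

(* Only parameters in the open interval ]0, 1[ are compared: in property_E
   below the coincidence g 0 = g 1 = z0 is the closing up of the curve, and
   simple_base_point rules out any other coincidence with an end point.
   Derivability excludes self-intersections at a corner of the curve. *)
Definition transversal_self_intersections g :=
  forall s t, 0 < s -> s < t -> t < 1 -> g s = g t ->
    [/\ cderivable g s, cderivable g t
      & transversal (velocity g s) (velocity g t)].

Definition simple_base_point g z0 :=
  forall t, t \in `[0, 1] -> g t = z0 -> t = 0 \/ t = 1.

Definition boundary (A : set R[i]) : set R[i] := closure A `\` A^°.

Definition is_unbounded_component (K U : set R[i]) :=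
  exists z, [/\ ~ K z, U = connected_component (~` K) z & ~ bounded_set U].

Definition property_E (P : {poly R[i]}) (a b z0 : R[i]) :=
  P.[a] = z0 /\ P.[b] = z0 /\
  exists Gamma : R -> R[i], let gamma := fun t => P.[Gamma t] in
    [/\ [/\ Gamma 0 = a, Gamma 1 = b & piecewise_smooth Gamma 0 1],
        transversal_self_intersections gamma,
        simple_base_point gamma z0
      & exists U : set R[i],
          is_unbounded_component (gamma @` `[0, 1]) U /\ boundary U z0].

Definition convex_hull n (c : 'I_n -> R[i]) : set R[i] :=
  [set z | exists l : 'I_n -> R,
     [/\ forall k, 0 <= l k, \sum_(k < n) l k = 1
       & z = \sum_(k < n) (l k)%:C * c k]].

End PropertyE.

(* Main.v *)
Require Import Defs.
From mathcomp Require Import zify ring lra.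

(** The point of the convex hull of the coefficients nearest to 0 yields a
    direction w with Re (conj w * a_k) > 0 for every k
    ([convex_hull_separation]).  Powers of a nonnegative x being nonnegative,
    Re (conj w * P1(x)) >= Re (conj w * a_0) > 0 on [a, b], so P maps the open
    segment ]a, b[ into the open half-plane Re (conj w * z) > 0 and both end
    points to 0.  A curve with these properties passes through 0 only at its
    ends, and the opposite open half-plane, which it avoids, lies in the
    unbounded component of the complement and has 0 in its closure
    ([half_plane_component]).

    The segment itself need not do for Gamma, since its image may run back over
    itself (it does when P is real) or touch itself.  Gamma is therefore taken
    to be a graph x + i y(x) over [a, b], with y = m k, m = (x - a)(b - x), and
    k = c0 + c1 x + c2 x^2 + c3 x^3 a small real cubic.  The factor m keeps the
    ends fixed, and since (Gamma - a)(b - Gamma) is m times a factor close to 1,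
    the curve stays in the half-plane when k is small ([small_perturbation]).

    That a suitable arbitrarily small k makes all self-intersections
    transversal is a count of dimensions.  A tangential self-intersection at
    x <> x' involves six real quantities x, x', y(x), y(x'), y'(x), y'(x'), which
    determine (c0, c1, c2, c3) by Hermite interpolation.  They are not
    free: u = x + i y(x) and v = x' + i y(x') satisfy P(u) = P(v), so v is
    determined by u up to finitely many choices, and tangency determines y'(x')
    from the rest.  Only u and y'(x) remain, three real parameters: on the set of
    tangential self-intersections, c0, ..., c3 are algebraic functions of three
    functions.  Four such functions satisfy a fixed nontrivial polynomial
    relation ([algebraic_relation]), because monomials of degree less than N in
    four unknowns number N^4 while they span a space of dimension O(N^3).  Any
    small (c0, ..., c3) violating the relation therefore has no tangential
    self-intersection, except possibly at critical points of P, and these are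
    avoided by excluding finitely many values of c0
    ([critical_avoidance], [generic_graph]). *)

Set Implicit Arguments.
Unset Strict Implicit.
Unset Printing Implicit Defensive.

Local Open Scope ring_scope.

(** * Linear spans of functions *)

Section Span.
Context {F : fieldType} {W : Type}.
Implicit Types (f g h : W -> F) (G H : (W -> F) -> Prop).

Inductive span G : (W -> F) -> Prop :=
| span_zero : span G (fun=> 0)
| span_step x g f : G g -> span G f -> span G (fun w => x * g w + f w).

Lemma span_ext G f g : (forall w, f w = g w) -> span G f -> span G g.
Proof. by move=> /funext->. Qed.

Lemma span_gen G g : G g -> span G g.
Proof.
move=> Gg; apply: (span_ext _ (span_step 1 Gg (span_zero G))) => w.
by rewrite mul1r addr0.
Qed.

Lemma span_scale G x f : span G f -> span G (fun w => x * f w).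
Proof.
elim=> [|y g h Gg _ IH].
  by apply: span_ext (span_zero G) => w; rewrite mulr0.
by apply: span_ext (span_step (x * y) Gg IH) => w; rewrite mulrDr mulrA.
Qed.

Lemma spanD G f g : span G f -> span G g -> span G (fun w => f w + g w).
Proof.
move=> Sf Sg; elim: Sf => [|y h k Gh _ IH].
  by apply: span_ext Sg => w; rewrite add0r.
by apply: span_ext (span_step y Gh IH) => w; rewrite addrA.
Qed.

Lemma span_sub G H f : (forall g, G g -> span H g) -> span G f -> span H f.
Proof.
move=> GH; elim=> [|y g h Gg _ IH]; first exact: span_zero.
exact: spanD (span_scale y (GH _ Gg)) IH.
Qed.

Lemma span_sum G (I : Type) (r : seq I) (Q : pred I) (f : I -> W -> F) :
  (forall i, Q i -> span G (f i)) -> span G (fun w => \sum_(i <- r | Q i) f i w).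
Proof.
move=> Sf; elim: r => [|i r IH].
  by apply: span_ext (span_zero G) => w; rewrite big_nil.
case Qi: (Q i).
  by apply: span_ext (spanD (Sf i Qi) IH) => w; rewrite big_cons Qi.
by apply: span_ext IH => w; rewrite big_cons Qi.
Qed.

Lemma span_mul G H K f g :
  (forall f' g', G f' -> H g' -> span K (fun w => f' w * g' w)) ->
  span G f -> span H g -> span K (fun w => f w * g w).
Proof.
move=> GHK Sf Sg; elim: Sf => [|x f' f1 Gf' _ IH].
  by apply: span_ext (span_zero K) => w; rewrite mul0r.
have Sf' : span K (fun w => f' w * g w).
  elim: Sg => [|y g' g1 Hg' _ IHg].
    by apply: span_ext (span_zero K) => w; rewrite mulr0.
  apply: span_ext (spanD (span_scale y (GHK _ _ Gf' Hg')) IHg) => w.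
  by rewrite mulrDr mulrCA.
apply: span_ext (spanD (span_scale x Sf') IH) => w.
by rewrite mulrDl mulrA.
Qed.

Lemma span_coef (I : finType) (e : I -> W -> F) f :
  span (fun g => exists i, g = e i) f ->
  exists x : I -> F, forall w, f w = \sum_i x i * e i w.
Proof.
elim=> [|y _ h [i ->] _ [x fE]].
  by exists (fun=> 0) => w; rewrite big1// => i _; rewrite mul0r.
exists (fun j => (if j == i then y else 0) + x j) => w.
under eq_bigr do rewrite mulrDl.
rewrite big_split/= -fE (bigD1 i)//= eqxx big1 ?addr0// => j /negPf->.
by rewrite mul0r.
Qed.

(** The coefficients of the functions f j on the family e form a matrix with more
    rows than columns, so its row kernel is nonzero. *)
Lemma dependent_of_card (I J : finType) (e : I -> W -> F) (f : J -> W -> F) :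
  (#|I| < #|J|)%N ->
  (forall j, span (fun g => exists i, g = e i) (f j)) ->
  exists q : J -> F,
    (exists j, q j != 0) /\ forall w, \sum_j q j * f j w = 0.
Proof.
move=> ltIJ Sf.
have /choice[x xE] := fun j => span_coef (Sf j).
pose A : 'M[F]_(#|J|, #|I|) := \matrix_(j, i) x (enum_val j) (enum_val i).
have kA : kermx A != 0.
  rewrite -mxrank_eq0 mxrank_ker -lt0n subn_gt0.
  exact: leq_ltn_trans (rank_leq_col A) ltIJ.
have /rowV0Pn[q /sub_kermxP qA q0] := kA.
exists (fun j => q 0 (enum_rank j)); split.
  by have /rV0Pn[j qj] := q0; exists (enum_val j); rewrite enum_valK.
move=> w; under eq_bigr do rewrite xE mulr_sumr.
rewrite exchange_big/= big1// => i _.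
under eq_bigr do rewrite mulrA.
rewrite -mulr_suml.
have := congr1 (fun M : 'M[F]_(1, #|I|) => M 0 (enum_rank i)) qA.
rewrite !mxE (reindex enum_rank)/=; last first.
  by exists enum_val => j _; rewrite ?enum_rankK ?enum_valK.
under eq_bigr do rewrite mxE !enum_rankK.
by move=> ->; rewrite mul0r.
Qed.

End Span.

(** * Reduction of powers of a root *)

Section Reduction.
Context {F : fieldType} {W : Type}.
Variables (P : {poly F}) (u v : W -> F).
Hypothesis P_gt1 : (1 < size P)%N.
Hypothesis Puv : forall w, P.[v w] = P.[u w].
Local Notation d := (size P).-1.

Definition reduced_le N (f : W -> F) := exists i j : nat,
  [/\ (i + j <= N)%N, (j < d)%N & f = (fun w => u w ^+ i * v w ^+ j)].

(** The relation P(v) = P(u) expresses v^d through lower powers of v and powers of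
    u up to d, so that the total degree in u and v does not grow. *)
Lemma reduced_top i N : (i + d <= N)%N ->
  span (reduced_le N) (fun w => u w ^+ i * v w ^+ d).
Proof.
move=> leN.
have lP : lead_coef P != 0 by rewrite lead_coef_eq0 -size_poly_gt0 ltnW.
have dP : size P = d.+1 by rewrite prednK// ltnW.
have d0 : (0 < d)%N by lia.
apply: (@span_ext _ _ _ (fun w => (lead_coef P)^-1 *
   (\sum_(k < size P) (P`_k * (u w ^+ (i + k) * v w ^+ 0)) +
    (-1) * \sum_(k < d) (P`_k * (u w ^+ i * v w ^+ k))))).
  move=> w; apply: (mulfI lP); rewrite mulVKf//.
  have := Puv w; rewrite !horner_coef [in LHS]dP big_ord_recr/=.
  move=> /(congr1 (fun z => u w ^+ i * z)).
  rewrite mulrDr !mulr_sumr => /(canRL (addKr _)).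
  rewrite /lead_coef mulrCA => ->; rewrite addrC -mulr_sumr mulN1r.
  congr (- _ + _); apply: eq_bigr => k _; first by rewrite mulrCA.
  by rewrite exprD expr0; ring.
apply: span_scale; apply: spanD.
  apply: span_sum => k _; apply/span_scale/span_gen.
  by exists (i + k)%N, 0%N; split => //; have := ltn_ord k; lia.
apply: span_scale; apply: span_sum => k _; apply/span_scale/span_gen.
by exists i, (k : nat); split => //; have := ltn_ord k; lia.
Qed.

Lemma span_reduced i e N : (i + e <= N)%N ->
  span (reduced_le N) (fun w => u w ^+ i * v w ^+ e).
Proof.
elim: e i N => [|e IH] i N le1.
  by apply: span_gen; exists i, 0%N; split => //; lia.
have IHe : span (reduced_le N.-1) (fun w => u w ^+ i * v w ^+ e) by apply: IH; lia.
apply: (@span_ext _ _ _ (fun w => (u w ^+ i * v w ^+ e) * v w)).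
  by move=> w; rewrite exprSr mulrA.
apply: (span_mul (H := fun g => g = v) _ IHe); last exact: span_gen.
move=> _ _ [j [k [jk kd ->]]] ->.
have [kd1|kd1] := ltnP k.+1 d.
  apply: span_gen; exists j, k.+1; split => //; first by lia.
  by apply/funext => w; rewrite exprSr mulrA.
have kE : d = k.+1 by lia.
apply: span_ext (@reduced_top j N _); last by lia.
by move=> w; rewrite kE exprSr mulrA.
Qed.

End Reduction.

(** * Algebraic functions of three base functions *)

(** In the application u' and v' are the complex conjugates of u and v.  The
    functions v and v' are finite over u and u' respectively, so that only u, u'
    and p count as independent. *)
Section Algebraic.
Context {F : fieldType} {W : Type}.
Variables (u u' v v' p : W -> F).
Implicit Types (f g h : W -> F).

Definition monomial_le N f := exists i j k l m : nat,
  (i + j + k + l + m <= N)%N /\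
  f = (fun w => u w ^+ i * v w ^+ j * u' w ^+ k * v' w ^+ l * p w ^+ m).

Local Notation L N := (span (monomial_le N)).

Lemma L_mul N M f g : L N f -> L M g -> L (N + M) (fun w => f w * g w).
Proof.
apply: span_mul => _ _ [i [j [k [l [m [le1 ->]]]]]] [i1 [j1 [k1 [l1 [m1 [le2 ->]]]]]].
apply: span_gen; exists (i + i1)%N, (j + j1)%N, (k + k1)%N, (l + l1)%N, (m + m1)%N.
split; first by lia.
by apply/funext => w; rewrite !exprD; ring.
Qed.

Lemma L_cst N x : L N (fun=> x).
Proof.
have H : monomial_le N (fun=> 1).
  exists 0%N, 0%N, 0%N, 0%N, 0%N; split => //.
  by apply/funext => w; rewrite !expr0 !mulr1.
by apply: span_ext (span_scale x (span_gen H)) => w; rewrite mulr1.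
Qed.

Lemma L_exp N f n : L N f -> L (n * N) (fun w => f w ^+ n).
Proof.
move=> Lf; elim: n => [|n IH]; first exact: L_cst.
by rewrite mulSn; apply: span_ext (L_mul Lf IH) => w; rewrite exprS.
Qed.

(** These are the functions which become polynomial in u, v, u', v', p after
    multiplication by a polynomial without zeros on W.  They form a ring closed
    under inversion of the functions without zeros ([algebraicV]), which replaces
    a fraction field here: W need not be irreducible. *)
Definition algebraic f := exists k h,
  [/\ L k h, forall w, h w != 0 & L k (fun w => h w * f w)].

Lemma algebraic_ext f g : (forall w, f w = g w) -> algebraic f -> algebraic g.
Proof. by move=> /funext->. Qed.

Lemma algebraic_L k f : L k f -> algebraic f.
Proof.
move=> Lf; exists k, (fun=> 1); split; first exact: L_cst.
  by move=> w; exact: oner_neq0.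
by apply: span_ext Lf => w; rewrite mul1r.
Qed.

Lemma algebraic_cst x : algebraic (fun=> x).
Proof. exact: algebraic_L (L_cst 0 x). Qed.

Lemma algebraic_u : algebraic u.
Proof.
apply: (@algebraic_L 1); apply: span_gen; exists 1%N, 0%N, 0%N, 0%N, 0%N.
by split => //; apply/funext => w; rewrite !expr0 expr1 !mulr1.
Qed.

Lemma algebraic_v : algebraic v.
Proof.
apply: (@algebraic_L 1); apply: span_gen; exists 0%N, 1%N, 0%N, 0%N, 0%N.
by split => //; apply/funext => w; rewrite !expr0 expr1 !mulr1 mul1r.
Qed.

Lemma algebraic_u' : algebraic u'.
Proof.
apply: (@algebraic_L 1); apply: span_gen; exists 0%N, 0%N, 1%N, 0%N, 0%N.
by split => //; apply/funext => w; rewrite !expr0 expr1 !mulr1 mul1r.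
Qed.

Lemma algebraic_v' : algebraic v'.
Proof.
apply: (@algebraic_L 1); apply: span_gen; exists 0%N, 0%N, 0%N, 1%N, 0%N.
by split => //; apply/funext => w; rewrite !expr0 expr1 !mulr1 mul1r.
Qed.

Lemma algebraic_p : algebraic p.
Proof.
apply: (@algebraic_L 1); apply: span_gen; exists 0%N, 0%N, 0%N, 0%N, 1%N.
by split => //; apply/funext => w; rewrite !expr0 expr1 !mulr1 mul1r.
Qed.

Lemma algebraicD f g : algebraic f -> algebraic g -> algebraic (fun w => f w + g w).
Proof.
move=> [k [h [Lh h0 Lhf]]] [l [e [Le e0 Leg]]].
exists (k + l)%N, (fun w => h w * e w); split; first exact: L_mul.
  by move=> w; rewrite mulf_neq0.
apply: span_ext (spanD (L_mul Lhf Le) (L_mul Lh Leg)) => w; ring.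
Qed.

Lemma algebraicM f g : algebraic f -> algebraic g -> algebraic (fun w => f w * g w).
Proof.
move=> [k [h [Lh h0 Lhf]]] [l [e [Le e0 Leg]]].
exists (k + l)%N, (fun w => h w * e w); split; first exact: L_mul.
  by move=> w; rewrite mulf_neq0.
apply: span_ext (L_mul Lhf Leg) => w; ring.
Qed.

Lemma algebraicB f g : algebraic f -> algebraic g -> algebraic (fun w => f w - g w).
Proof.
move=> Af Ag; apply: algebraic_ext (algebraicD Af (algebraicM (algebraic_cst (-1)) Ag)) => w.
by rewrite mulN1r.
Qed.

Lemma algebraicX f n : algebraic f -> algebraic (fun w => f w ^+ n).
Proof.
move=> Af; elim: n => [|n IH]; first exact: algebraic_cst.
by apply: algebraic_ext (algebraicM Af IH) => w; rewrite exprS.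
Qed.

Lemma algebraic_horner (q : {poly F}) f :
  algebraic f -> algebraic (fun w => q.[f w]).
Proof.
move=> Af; elim/poly_ind: q => [|q x IH].
  by apply: algebraic_ext (algebraic_cst 0) => w; rewrite horner0.
apply: algebraic_ext (algebraicD (algebraicM IH Af) (algebraic_cst x)) => w.
by rewrite hornerMXaddC.
Qed.

Lemma algebraicV f : (forall w, f w != 0) -> algebraic f ->
  algebraic (fun w => (f w)^-1).
Proof.
move=> f0 [k [h [Lh h0 Lhf]]].
exists k, (fun w => h w * f w); split => //.
  by move=> w; rewrite mulf_neq0.
by apply: span_ext Lh => w; rewrite mulfK.
Qed.

(** The denominator h^N serves all the powers f^i with i <= N at once, so that the
    monomials of [algebraic_relation] get a common denominator. *)
Lemma algebraic_power f : algebraic f -> exists k h,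
  (forall w, h w != 0) /\ forall N i, (i <= N)%N ->
    L (N * k) (fun w => h w ^+ N * f w ^+ i).
Proof.
move=> [k [h [Lh h0 Lhf]]]; exists k, h; split => // N i leiN.
have := L_mul (L_exp (N - i) Lh) (L_exp i Lhf); rewrite -mulnDl subnK//.
by apply: span_ext => w; rewrite exprMn mulrA -exprD subnK.
Qed.

End Algebraic.

Section Relation.
Context {F : fieldType} {W : Type}.
Variables (P P' : {poly F}) (u u' v v' p : W -> F).
Hypotheses (P_gt1 : (1 < size P)%N) (P'_gt1 : (1 < size P')%N).
Hypotheses (Puv : forall w, P.[v w] = P.[u w])
           (P'uv : forall w, P'.[v' w] = P'.[u' w]).
Local Notation L N := (span (monomial_le u u' v v' p N)).
Local Notation algebraic := (algebraic u u' v v' p).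

(** A polynomial of degree at most N in u, v, u', v', p is a combination of
    monomials with bounded exponents of v and v', hence of O(N^3) functions. *)
Lemma L_reduced N f : L N f ->
  span (fun g => exists x : 'I_N.+1 * 'I_N.+1 * 'I_N.+1 *
                            'I_(size P).-1 * 'I_(size P').-1,
     g = (fun w => u w ^+ x.1.1.1.1 * v w ^+ x.1.2 *
                   (u' w ^+ x.1.1.1.2 * v' w ^+ x.2) * p w ^+ x.1.1.2)) f.
Proof.
apply: span_sub => _ [i [j [k [l [m [leN ->]]]]]].
have S1 : span (reduced_le P u v N) (fun w => u w ^+ i * v w ^+ j).
  by apply: span_reduced => //; lia.
have S2 : span (reduced_le P' u' v' N) (fun w => u' w ^+ k * v' w ^+ l).
  by apply: span_reduced => //; lia.
apply: (@span_ext _ _ _ (fun w => (u w ^+ i * v w ^+ j) *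
   (u' w ^+ k * v' w ^+ l) * p w ^+ m)); first by move=> w; ring.
apply: (span_mul (G := fun g => exists f1 f2, [/\ reduced_le P u v N f1,
    reduced_le P' u' v' N f2 & g = (fun w => f1 w * f2 w)])
  (H := fun g => g = (fun w => p w ^+ m))); last exact: span_gen.
- move=> _ _ [_ [_ [[i1 [j1 [le1 lj1 ->]]] [i2 [j2 [le2 lj2 ->]]] ->]]] ->.
  have l1 : (i1 < N.+1)%N by lia.
  have l2 : (i2 < N.+1)%N by lia.
  have l3 : (m < N.+1)%N by lia.
  apply: span_gen.
  by exists (Ordinal l1, Ordinal l2, Ordinal l3, Ordinal lj1, Ordinal lj2).
- apply: (span_mul _ S1 S2) => f1 f2 S1' S2'.
  by apply: span_gen; exists f1, f2.
Qed.

(** There are N^4 monomials f0^i f1^j f2^k f3^l with exponents less than N.  After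
    multiplication by a common denominator all of them have degree O(N), and hence
    lie in the span of O(N^3) functions by [L_reduced]; for large N they are
    linearly dependent. *)
Theorem algebraic_relation f0 f1 f2 f3 :
  algebraic f0 -> algebraic f1 -> algebraic f2 -> algebraic f3 ->
  exists N (q : 'I_N * 'I_N * 'I_N * 'I_N -> F), (exists j, q j != 0) /\
    forall w, \sum_j q j * (f0 w ^+ j.1.1.1 * f1 w ^+ j.1.1.2 *
                            f2 w ^+ j.1.2 * f3 w ^+ j.2) = 0.
Proof.
move=> /algebraic_power[k0 [h0 [nz0 L0]]] /algebraic_power[k1 [h1 [nz1 L1]]].
move=> /algebraic_power[k2 [h2 [nz2 L2]]] /algebraic_power[k3 [h3 [nz3 L3]]].
pose k := (k0 + k1 + k2 + k3)%N.
pose dd := ((size P).-1 * (size P').-1)%N.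
(* For this N the reduced monomials of degree at most N k, whose number is at most
   (N (k + 1))^3 dd, are fewer than N^4. *)
pose N := (k.+1 ^ 3 * dd).+1.
exists N.
pose J : finType := ('I_N * 'I_N * 'I_N * 'I_N)%type.
pose M := (N * k)%N.
have cardJ : (#|{: 'I_M.+1 * 'I_M.+1 * 'I_M.+1 *
                   'I_(size P).-1 * 'I_(size P').-1}| < #|J|)%N.
  rewrite !card_prod !card_ord.
  have leM : (M.+1 <= N * k.+1)%N by rewrite mulnS /M ltnS leq_addl.
  apply: (@leq_ltn_trans (N * k.+1 * (N * k.+1) * (N * k.+1) * dd)%N).
    by rewrite /dd mulnA !leq_mul.
  suff -> : (N * k.+1 * (N * k.+1) * (N * k.+1) * dd = N * N * N * (k.+1 ^ 3 * dd))%N.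
    by rewrite ltn_pmul2l// !muln_gt0.
  rewrite !expnS expn0; lia.
have Lprod (j : J) : L M (fun w => h0 w ^+ N * f0 w ^+ j.1.1.1 *
    (h1 w ^+ N * f1 w ^+ j.1.1.2) * (h2 w ^+ N * f2 w ^+ j.1.2) *
    (h3 w ^+ N * f3 w ^+ j.2)).
  have -> : M = (N * k0 + N * k1 + N * k2 + N * k3)%N by rewrite /M /k !mulnDr.
  have le i : (nat_of_ord (i : 'I_N) <= N)%N by exact: ltnW.
  exact: L_mul (L_mul (L_mul (L0 N _ (le _)) (L1 N _ (le _))) (L2 N _ (le _)))
               (L3 N _ (le _)).
have [q [q0 qE]] := dependent_of_card cardJ (fun j => L_reduced (Lprod j)).
exists q; split => // w.
apply: (mulfI (x := h0 w ^+ N * h1 w ^+ N * h2 w ^+ N * h3 w ^+ N)).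
  by rewrite !mulf_neq0 ?expf_neq0.
rewrite mulr0 -[RHS](qE w) mulr_sumr; apply: eq_bigr => j _; ring.
Qed.

End Relation.

(** * Choosing values outside a hypersurface *)

Section Choice.
Context {F : fieldType}.
Variable S : nat -> F.
Hypothesis S_inj : injective S.

Lemma exists_nonroot (p : {poly F}) : p != 0 -> exists n, p.[S n] != 0.
Proof.
move=> p0; apply: contrapT => /forallNP pS.
have /(max_poly_roots p0) : all (root p) [seq S n | n <- iota 0 (size p)].
  by apply/allP => _ /mapP[n _ ->]; apply/negPn/negP/pS.
by rewrite map_inj_uniq// iota_uniq size_map size_iota ltnn => /(_ isT).
Qed.

(** One step of the usual proof that a nonzero polynomial in several variables does
    not vanish on a product of infinite sets: the last variable is specialized at
    a value which is neither a root of g nor a common root of the coefficients of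
    q as a polynomial in the remaining variables. *)
Lemma select_last (I : finType) N (q : I * 'I_N -> F) (g : {poly F}) :
  g != 0 -> (exists j, q j != 0) ->
  exists n, g.[S n] != 0 /\ exists i, \sum_k q (i, k) * S n ^+ k != 0.
Proof.
move=> g0 [[i k] qik].
pose p := \poly_(l < N) (if insub l is Some l' then q (i, l') else 0).
have pE x : p.[x] = \sum_k q (i, k) * x ^+ k.
  by rewrite horner_poly; apply: eq_bigr => l _; rewrite valK.
have p0 : p != 0.
  apply/eqP => /(congr1 (fun r : {poly F} => r`_k)).
  by rewrite coef0 coef_poly ltn_ord valK => /eqP; apply/negP.
have [n] := exists_nonroot (mulf_neq0 g0 p0).
rewrite hornerM mulf_eq0 negb_or => /andP[gn pn].
by exists n; split => //; exists i; rewrite -pE.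
Qed.

(** The first variable is specialized last, because the extra polynomial g to be
    avoided is only known to be nonzero once the other three are fixed. *)
Lemma select_parameters N (q : 'I_N * 'I_N * 'I_N * 'I_N -> F)
    (g : F -> F -> F -> {poly F}) :
  (forall x y z, g x y z != 0) -> (exists j, q j != 0) ->
  exists n0 n1 n2 n3, (g (S n1) (S n2) (S n3)).[S n0] != 0 /\
    \sum_j q j * (S n0 ^+ j.1.1.1 * S n1 ^+ j.1.1.2 *
                  S n2 ^+ j.1.2 * S n3 ^+ j.2) != 0.
Proof.
move=> g0 qj.
have [n3 [_ q3]] := select_last (oner_neq0 _) qj.
have [n2 [_ q2]] := select_last
  (q := fun i => \sum_k q (i, k) * S n3 ^+ k) (oner_neq0 _) q3.
have [n1 [_ [i0 q1]]] := select_last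
  (q := fun i => \sum_l (\sum_k q (i, l, k) * S n3 ^+ k) * S n2 ^+ l)
  (oner_neq0 _) q2.
have [|n0 [gn [[] q0]]] := select_last
  (q := fun i : unit * 'I_N => \sum_m
     (\sum_l (\sum_k q (i.2, m, l, k) * S n3 ^+ k) * S n2 ^+ l) * S n1 ^+ m)
  (g0 (S n1) (S n2) (S n3)); first by exists (tt, i0).
exists n0, n1, n2, n3; split => //.
apply: contraNneq q0 => E; apply/eqP; rewrite -[RHS]E.
rewrite [RHS](_ : _ = \sum_i \sum_m \sum_l \sum_k q (i, m, l, k) *
    (S n0 ^+ i * S n1 ^+ m * S n2 ^+ l * S n3 ^+ k)); last first.
  by rewrite !pair_bigA; apply: eq_bigr => -[[[i m] l] k].
apply: eq_bigr => i _; rewrite mulr_suml; apply: eq_bigr => m _.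
rewrite !mulr_suml; apply: eq_bigr => l _.
rewrite !mulr_suml; apply: eq_bigr => k _; ring.
Qed.

End Choice.

Local Open Scope complex_scope.

(** * Tangential self-intersections *)

Section Relation.
Context {R : realType}.
Local Notation C := R[i].
Local Notation Re := (@complex.Re R).
Local Notation Im := (@complex.Im R).

Section RealAlgebraic.
Context {W : Type}.
Variables u u' v v' p : W -> C.
Local Notation alg := (algebraic u u' v v' p).

Definition real_algebraic (f : W -> R) := alg (fun w => (f w)%:C).

Lemma real_algebraic_ext f g : (forall w, f w = g w) -> real_algebraic f -> real_algebraic g.
Proof. by move=> /funext->. Qed.

Lemma real_algebraic_cst x : real_algebraic (fun=> x).
Proof. exact: algebraic_cst. Qed.

Lemma real_algebraicD f g : real_algebraic f -> real_algebraic g ->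
  real_algebraic (fun w => f w + g w).
Proof.
by move=> Af Ag; apply: algebraic_ext (algebraicD Af Ag) => w; rewrite -rmorphD.
Qed.

Lemma real_algebraicB f g : real_algebraic f -> real_algebraic g ->
  real_algebraic (fun w => f w - g w).
Proof.
by move=> Af Ag; apply: algebraic_ext (algebraicB Af Ag) => w; rewrite -rmorphB.
Qed.

Lemma real_algebraicM f g : real_algebraic f -> real_algebraic g ->
  real_algebraic (fun w => f w * g w).
Proof.
by move=> Af Ag; apply: algebraic_ext (algebraicM Af Ag) => w; rewrite -rmorphM.
Qed.

Lemma real_algebraicX f n : real_algebraic f -> real_algebraic (fun w => f w ^+ n).
Proof.
by move=> Af; apply: algebraic_ext (algebraicX n Af) => w; rewrite -rmorphXn.
Qed.

Lemma real_algebraicV f : (forall w, f w != 0) -> real_algebraic f ->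
  real_algebraic (fun w => (f w)^-1).
Proof.
move=> f0 Af.
apply: algebraic_ext (algebraicV _ Af) => w; first by rewrite -fmorphV.
by rewrite fmorph_eq0.
Qed.

Lemma real_algebraic_horner (q : {poly R}) f :
  real_algebraic f -> real_algebraic (fun w => q.[f w]).
Proof.
move=> Af; apply: algebraic_ext (algebraic_horner (map_poly (real_complex R) q) Af) => w.
by rewrite horner_map.
Qed.

Lemma real_algebraic_Re f : alg f -> alg (fun w => conjc (f w)) ->
  real_algebraic (fun w => Re (f w)).
Proof.
move=> Af Af'; apply: algebraic_ext
  (algebraicM (algebraic_cst u u' v v' p (2^-1)%:C) (algebraicD Af Af')) => w.
by case: (f w) => x y; simpc => /=; congr (_ +i* _); lra.
Qed.

Lemma real_algebraic_Im f : alg f -> alg (fun w => conjc (f w)) ->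
  real_algebraic (fun w => Im (f w)).
Proof.
move=> Af Af'; apply: algebraic_ext
  (algebraicM (algebraic_cst u u' v v' p (0 +i* - 2^-1)) (algebraicB Af Af')) => w.
by case: (f w) => x y; simpc => /=; congr (_ +i* _); lra.
Qed.

End RealAlgebraic.

Definition cubic (c0 c1 c2 c3 : R) : {poly R} :=
  c0%:P + c1 *: 'X + c2 *: 'X^2 + c3 *: 'X^3.

Lemma horner_cubic c0 c1 c2 c3 x :
  (cubic c0 c1 c2 c3).[x] = c0 + c1 * x + c2 * x ^+ 2 + c3 * x ^+ 3.
Proof. by rewrite /cubic !hornerE. Qed.

Lemma horner_deriv_cubic c0 c1 c2 c3 x :
  (cubic c0 c1 c2 c3)^`().[x] = c1 + 2 * c2 * x + 3 * c3 * x ^+ 2.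
Proof. by rewrite /cubic !poly.derivE !hornerE /=; ring. Qed.

(** Hermite interpolation: a cubic is determined by its values and slopes at two
    points.  The formulas are triangular, each coefficient being computed from
    those of higher degree. *)
Lemma cubic_coef c0 c1 c2 c3 x x' : x != x' ->
  let K := cubic c0 c1 c2 c3 in
  [/\ c3 = ((x' - x) * (K^`().[x] + K^`().[x']) - 2 * (K.[x'] - K.[x])) /
            (x' - x) ^+ 3,
      c2 = (K^`().[x'] - K^`().[x]) / (2 * (x' - x)) - 3 / 2 * c3 * (x + x'),
      c1 = K^`().[x] - 2 * c2 * x - 3 * c3 * x ^+ 2 &
      c0 = K.[x] - c1 * x - c2 * x ^+ 2 - c3 * x ^+ 3].
Proof.
move=> xx' K; rewrite /K !horner_cubic !horner_deriv_cubic.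
have x0 : x' - x != 0 by rewrite subr_eq0 eq_sym.
by split; try field; try ring.
Qed.

Definition graph (y : {poly R}) x : C := x +i* y.[x].

(** The graph of y has velocity 1 + i y'(x) at x, so the vectors compared are the
    velocities of its image under P.  Critical points of P are excluded because
    there any velocity of the graph would count as tangential. *)
Definition tangent_crossing (P : {poly C}) (y : {poly R}) x x' :=
  [/\ x != x', P.[graph y x] = P.[graph y x'],
      P^`().[graph y x] != 0, P^`().[graph y x'] != 0 &
      ~~ transversal (P^`().[graph y x] * (1 +i* y^`().[x]))
                     (P^`().[graph y x'] * (1 +i* y^`().[x']))].

(** For z = conj A * B, tangency reads t (Im z * s + Re z) = Re z * s - Im z.  If the
    coefficient of t vanished, so would the right-hand side, which forces
    Im z * (1 + s^2) = 0, then Re z = Im z = 0, against A B <> 0. *)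
Lemma tangent_slope (A B : C) (s t : R) : A != 0 -> B != 0 ->
  ~~ transversal (A * (1 +i* s)) (B * (1 +i* t)) ->
  let z := conjc A * B in
  Im z * s + Re z != 0 /\ t = (Re z * s - Im z) / (Im z * s + Re z).
Proof.
case: A B => [a1 a2] [b1 b2] A0 B0; rewrite /transversal negbK /= => /eqP E.
have za : a1 ^+ 2 + a2 ^+ 2 != 0.
  apply: contra A0; rewrite paddr_eq0 ?sqr_ge0// !sqrf_eq0 => /andP[/eqP-> /eqP->] //.
have zb : b1 ^+ 2 + b2 ^+ 2 != 0.
  apply: contra B0; rewrite paddr_eq0 ?sqr_ge0// !sqrf_eq0 => /andP[/eqP-> /eqP->] //.
set X := a1 * b1 - - a2 * b2; set Y := a1 * b2 + - a2 * b1.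
have XY : X ^+ 2 + Y ^+ 2 != 0.
  rewrite (_ : _ + _ = (a1 ^+ 2 + a2 ^+ 2) * (b1 ^+ 2 + b2 ^+ 2)) ?mulf_neq0//.
  by rewrite /X /Y; ring.
have E1 : t * (Y * s + X) = X * s - Y.
  by rewrite /X /Y; lra.
have H : Y * s + X != 0.
  apply: contra XY => /eqP H.
  have XE : X = - (Y * s) by lra.
  have /eqP : Y * (s ^+ 2 + 1) = 0.
    rewrite H mulr0 in E1; rewrite XE in E1; lra.
  rewrite mulf_eq0 => /orP[/eqP Y0|].
    by rewrite XE Y0 mul0r oppr0 expr0n addr0.
  by rewrite gt_eqF// ltr_wpDl// sqr_ge0.
by split=> //; apply: (mulIf H); rewrite E1 divfK.
Qed.

Lemma conjc_horner (P : {poly C}) z :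
  (map_poly (@conjc R) P).[conjc z] = conjc P.[z].
Proof. exact: horner_map. Qed.

Lemma horner_derivM (p q : {poly R}) x :
  (p * q)^`().[x] = p^`().[x] * q.[x] + p.[x] * q^`().[x].
Proof. by rewrite poly.derivM hornerD !hornerM. Qed.

(** The set W of all tangential self-intersections is considered as a space on which
    the coefficients of the cubic are functions.  All of them are algebraic over
    u = x + i y(x), its conjugate and p = k'(x): the conjugates of u and v give the
    coordinates of both points, hence the values of k; the slope at x comes from
    p, the slope at x' from tangency; and [cubic_coef] recovers the
    coefficients. *)
Theorem tangent_crossing_relation (P : {poly C}) (m : {poly R}) :
  (1 < size P)%N ->
  exists N (q : 'I_N * 'I_N * 'I_N * 'I_N -> C), (exists j, q j != 0) /\
    forall c0 c1 c2 c3 x x', m.[x] != 0 -> m.[x'] != 0 ->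
      tangent_crossing P (m * cubic c0 c1 c2 c3) x x' ->
      \sum_j q j * (c0%:C ^+ j.1.1.1 * c1%:C ^+ j.1.1.2 *
                    c2%:C ^+ j.1.2 * c3%:C ^+ j.2) = 0.
Proof.
move=> P_gt1.
pose W := {t : (R * R * R * R) * (R * R) |
  [/\ m.[t.2.1] != 0, m.[t.2.2] != 0 &
  tangent_crossing P (m * cubic t.1.1.1.1 t.1.1.1.2 t.1.1.2 t.1.2) t.2.1 t.2.2]}.
pose c0 (w : W) := (sval w).1.1.1.1.
pose c1 (w : W) := (sval w).1.1.1.2.
pose c2 (w : W) := (sval w).1.1.2.
pose c3 (w : W) := (sval w).1.2.
pose x (w : W) := (sval w).2.1.
pose x' (w : W) := (sval w).2.2.
pose K w := cubic (c0 w) (c1 w) (c2 w) (c3 w).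
pose y w := m * K w.
have mx w : m.[x w] != 0 by case: (svalP w).
have mx' w : m.[x' w] != 0 by case: (svalP w).
have tc w : tangent_crossing P (y w) (x w) (x' w) by case: (svalP w).
pose u w := graph (y w) (x w).
pose v w := graph (y w) (x' w).
pose u' w := conjc (u w).
pose v' w := conjc (v w).
pose p w : C := ((K w)^`().[x w])%:C.
pose P' := map_poly (@conjc R) P.
have P'_gt1 : (1 < size P')%N by rewrite size_map_poly.
have Puv w : P.[v w] = P.[u w] by case: (tc w) => _ <-.
have conju (Q : {poly C}) w : (map_poly (@conjc R) Q).[u' w] = conjc Q.[u w].
  exact: conjc_horner.
have conjv (Q : {poly C}) w : (map_poly (@conjc R) Q).[v' w] = conjc Q.[v w].
  exact: conjc_horner.
have P'uv w : P'.[v' w] = P'.[u' w] by rewrite conju conjv Puv.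
pose ralg (f : W -> R) := real_algebraic u u' v v' p f.
have Au := algebraic_u u u' v v' p; have Av := algebraic_v u u' v v' p.
have Au' := algebraic_u' u u' v v' p; have Av' := algebraic_v' u u' v v' p.
have Ax : ralg x by exact: real_algebraic_Re Au Au'.
have Ax' : ralg x' by exact: real_algebraic_Re Av Av'.
have Ay : ralg (fun w => (y w).[x w]) by exact: real_algebraic_Im Au Au'.
have Ay' : ralg (fun w => (y w).[x' w]) by exact: real_algebraic_Im Av Av'.
have Am := real_algebraic_horner m Ax.
have Am' := real_algebraic_horner m Ax'.
have AK : ralg (fun w => (K w).[x w]).
  apply: real_algebraic_ext (real_algebraicM Ay (real_algebraicV mx Am)) => w.
  by rewrite hornerM mulrC mulKf.
have AK' : ralg (fun w => (K w).[x' w]).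
  apply: real_algebraic_ext (real_algebraicM Ay' (real_algebraicV mx' Am')) => w.
  by rewrite hornerM mulrC mulKf.
have Ap : ralg (fun w => (K w)^`().[x w]) by exact: algebraic_p.
pose s w := (y w)^`().[x w].
pose t w := (y w)^`().[x' w].
have As : ralg s.
  apply: real_algebraic_ext (real_algebraicD
    (real_algebraicM (real_algebraic_horner m^`() Ax) AK)
    (real_algebraicM Am Ap)) => w.
  by rewrite /s /y horner_derivM.
pose z w := conjc P^`().[u w] * P^`().[v w].
have Az : algebraic u u' v v' p z.
  apply: algebraicM; last exact: algebraic_horner Av.
  apply: algebraic_ext (algebraic_horner (map_poly (@conjc R) P^`()) Au') => w.
  by rewrite conju.
have Az' : algebraic u u' v v' p (fun w => conjc (z w)).
  apply: algebraic_ext (algebraicM (algebraic_horner P^`() Au)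
    (algebraic_horner (map_poly (@conjc R) P^`()) Av')) => w.
  by rewrite conjv /z rmorphM /= conjcK.
have Aa := real_algebraic_Re Az Az'.
have Ab := real_algebraic_Im Az Az'.
have slope w : Im (z w) * s w + Re (z w) != 0 /\
    t w = (Re (z w) * s w - Im (z w)) / (Im (z w) * s w + Re (z w)).
  by case: (tc w) => _ _ nzu nzv; exact: tangent_slope.
have At : ralg t.
  apply: real_algebraic_ext (real_algebraicM
    (real_algebraicB (real_algebraicM Aa As) Ab)
    (real_algebraicV (fun w => (slope w).1)
       (real_algebraicD (real_algebraicM Ab As) Aa))) => w.
  by rewrite (slope w).2.
have Ap' : ralg (fun w => (K w)^`().[x' w]).
  apply: real_algebraic_ext (real_algebraicM
    (real_algebraicB At (real_algebraicM (real_algebraic_horner m^`() Ax') AK'))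
    (real_algebraicV mx' Am')) => w.
  by rewrite /t /y horner_derivM addrAC subrr add0r mulrC mulKf.
have xx' w : x' w - x w != 0 by case: (tc w) => xx' *; rewrite subr_eq0 eq_sym.
have Ad := real_algebraicB Ax' Ax.
have E w := cubic_coef (c0 w) (c1 w) (c2 w) (c3 w) (let: And5 H _ _ _ _ := tc w in H).
have cst c : ralg (fun=> c) by exact: real_algebraic_cst.
have A3 : ralg c3.
  apply: real_algebraic_ext (real_algebraicM
     (real_algebraicB (real_algebraicM Ad (real_algebraicD Ap Ap'))
        (real_algebraicM (cst 2) (real_algebraicB AK' AK)))
     (real_algebraicV _ (real_algebraicX 3 Ad))) => w.
    by case: (E w).
  by rewrite expf_neq0.
have A2 : ralg c2.
  apply: real_algebraic_ext (real_algebraicB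
    (real_algebraicM (real_algebraicB Ap' Ap)
       (real_algebraicV _ (real_algebraicM (cst 2) Ad)))
    (real_algebraicM (real_algebraicM (cst (3 / 2)) A3) (real_algebraicD Ax Ax'))) => w.
    by case: (E w).
  by rewrite mulf_neq0// pnatr_eq0.
have A1 : ralg c1.
  apply: real_algebraic_ext (real_algebraicB (real_algebraicB Ap
    (real_algebraicM (real_algebraicM (cst 2) A2) Ax))
    (real_algebraicM (real_algebraicM (cst 3) A3) (real_algebraicX 2 Ax))) => w.
  by case: (E w).
have A0 : ralg c0.
  apply: real_algebraic_ext (real_algebraicB (real_algebraicB (real_algebraicB AK
    (real_algebraicM A1 Ax)) (real_algebraicM A2 (real_algebraicX 2 Ax)))
    (real_algebraicM A3 (real_algebraicX 3 Ax))) => w.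
  by case: (E w).
have [N [q [q0 qE]]] := algebraic_relation P_gt1 P'_gt1 Puv P'uv A0 A1 A2 A3.
exists N, q; split => // d0 d1 d2 d3 a a' ma ma' tca.
by have := qE (exist _ (d0, d1, d2, d3, (a, a')) (And3 ma ma' tca)).
Qed.

End Relation.

Local Open Scope classical_set_scope.

(** * Separating the convex hull from the origin *)

Section Separation.
Context {R : realType}.
Local Notation C := R[i].
Local Notation Re := (@complex.Re R).
Local Notation Im := (@complex.Im R).

Lemma linear_form_continuous n (x : 'I_n -> R) :
  continuous (fun v : 'rV[R]_n => \sum_i v ord0 i * x i).
Proof.
move=> v; apply: cvg_big => [||i _]; [exact: add_continuous|exact: nbhs_filter|].
exact: (cvgM (@coord_continuous _ _ _ ord0 i v) (cvg_cst _)).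
Qed.

Lemma simplex_compact n : compact
  ([set v : 'rV[R]_n | forall i, `[0, 1]%classic (v ord0 i)] `&`
   [set v : 'rV[R]_n | \sum_i v ord0 i = 1]).
Proof.
apply: compact_closedI.
  have H := @rV_compact R n (fun=> `[0, 1]%classic).
  by apply: H => _; exact: segment_compact.
apply: (@preimage_closed _ _ (fun v : 'rV[R]_n => \sum_i v ord0 i) [set 1]).
  move=> v; have := @linear_form_continuous n (fun=> 1) v.
  by under eq_fun do under eq_bigr do rewrite mulr1.
exact: closed_eq.
Qed.

(** For B < 0 the value at t = - B / (D - B) is negative. *)
Lemma ge0_of_small_perturbation (B D : R) : 0 <= D ->
  (forall t, 0 <= t <= 1 -> 0 <= 2 * t * B + t ^+ 2 * D) -> 0 <= B.
Proof.
move=> D0 H; rewrite leNgt; apply/negP => B0.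
have s0 : 0 < D - B by lra.
have t01 : 0 <= - B / (D - B) <= 1.
  rewrite divr_ge0 ?(ltW s0) ?oppr_ge0 ?(ltW B0)//= ler_pdivrMr// mul1r; lra.
have := H _ t01; rewrite leNgt => /negP; apply.
have -> : 2 * (- B / (D - B)) * B + (- B / (D - B)) ^+ 2 * D =
    - (B ^+ 2 * (D - 2 * B) / (D - B) ^+ 2) by field; rewrite gt_eqF.
rewrite oppr_lt0 divr_gt0 ?exprn_gt0// mulr_gt0//; last by lra.
by rewrite exprn_even_gt0//= lt_eqF.
Qed.

(** The vector w is the point of the hull nearest to 0.  Moving from w towards
    c k does not decrease the distance to 0, so Re (conj w * (c k - w)) >= 0 and
    Re (conj w * c k) >= |w|^2 > 0. *)
Lemma convex_hull_separation n (c : 'I_n.+1 -> C) : ~ convex_hull c 0 ->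
  exists w : C, forall k, 0 < Re (conjc w * c k).
Proof.
move=> c0.
pose X (v : 'rV[R]_n.+1) := \sum_i v ord0 i * Re (c i).
pose Y (v : 'rV[R]_n.+1) := \sum_i v ord0 i * Im (c i).
pose f v := X v * X v + Y v * Y v.
pose D := [set v : 'rV[R]_n.+1 | forall i, `[0, 1]%classic (v ord0 i)] `&`
          [set v : 'rV[R]_n.+1 | \sum_i v ord0 i = 1].
pose e k : 'rV[R]_n.+1 := \row_i (i == k)%:R.
have De k : D (e k).
  split=> [i|] /=.
    by rewrite mxE in_itv/= ler0n lern1 leq_b1.
  by rewrite (bigD1 k)//= big1 ?mxE ?eqxx ?addr0// => i /negPf ik; rewrite mxE ik.
have fcont : continuous f.
  move=> v; have cX : X @ v --> X v by exact: linear_form_continuous.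
  have cY : Y @ v --> Y v by exact: linear_form_continuous.
  exact: (cvgD (cvgM cX cX) (cvgM cY cY)).
have [v /[!inE] Dv vmin] := EVT_min_rV (ex_intro _ _ (De ord0))
  (@simplex_compact _) (continuous_subspaceT fcont).
have XY0 : 0 < X v ^+ 2 + Y v ^+ 2.
  rewrite lt_neqAle addr_ge0 ?sqr_ge0// andbT eq_sym; apply/negP.
  rewrite paddr_eq0 ?sqr_ge0// !sqrf_eq0 => /andP[/eqP X0 /eqP Y0].
  apply: c0; exists (fun i => v ord0 i); split.
  - by move=> k; have := Dv.1 k; rewrite /= in_itv => /andP[].
  - exact: Dv.2.
  - apply/eqP; rewrite eq_complex raddf_sum raddf_sum/=; apply/andP; split; apply/eqP.
      by rewrite -[LHS]X0; apply: eq_bigr => i _; case: (c i) => a b /=; ring.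
    by rewrite -[LHS]Y0; apply: eq_bigr => i _; case: (c i) => a b /=; ring.
exists (X v +i* Y v) => k.
have Xe : X (e k) = Re (c k).
  rewrite /X (bigD1 k)//= mxE eqxx mul1r big1 ?addr0// => i /negPf ik.
  by rewrite mxE ik mul0r.
have Ye : Y (e k) = Im (c k).
  rewrite /Y (bigD1 k)//= mxE eqxx mul1r big1 ?addr0// => i /negPf ik.
  by rewrite mxE ik mul0r.
have segE (g : 'I_n.+1 -> R) t : \sum_i (v + t *: (e k - v)) ord0 i * g i =
    \sum_i v ord0 i * g i + t * (\sum_i e k ord0 i * g i - \sum_i v ord0 i * g i).
  rewrite -sumrB mulr_sumr -big_split/=; apply: eq_bigr => i _.
  by rewrite !mxE; ring.
have : 0 <= X v * (Re (c k) - X v) + Y v * (Im (c k) - Y v).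
  apply: (@ge0_of_small_perturbation _ ((Re (c k) - X v) ^+ 2 + (Im (c k) - Y v) ^+ 2)).
    by rewrite addr_ge0 ?sqr_ge0.
  move=> t /andP[t0 t1].
  have Dt : D (v + t *: (e k - v)).
    split=> [i|] /=.
      have := Dv.1 i; have := (De k).1 i; rewrite /= !in_itv/= !mxE.
      move=> /andP[? ?] /andP[? ?]; apply/andP; split; nra.
    have E1 (z : 'rV[R]_n.+1) : \sum_i z ord0 i * 1 = \sum_i z ord0 i.
      by apply: eq_bigr => i _; rewrite mulr1.
    by have := segE (fun=> 1) t; rewrite !E1 Dv.2 (De k).2 => ->; ring.
  have Xt : X (v + t *: (e k - v)) = X v + t * (Re (c k) - X v).
    by rewrite -Xe; exact: segE.
  have Yt : Y (v + t *: (e k - v)) = Y v + t * (Im (c k) - Y v).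
    by rewrite -Ye; exact: segE.
  have := vmin _ (mem_set Dt); rewrite -subr_ge0.
  rewrite (_ : f _ - f v = 2 * t * (X v * (Re (c k) - X v) + Y v * (Im (c k) - Y v)) +
    t ^+ 2 * ((Re (c k) - X v) ^+ 2 + (Im (c k) - Y v) ^+ 2))//.
  by rewrite /f Xt Yt; ring.
move: XY0; case: (c k) => a b /=; lra.
Qed.

End Separation.

(** * A half-plane in the unbounded component *)

Section HalfPlane.
Context {R : realType}.
Local Notation C := R[i].
Local Notation Re := (@complex.Re R).
Local Notation Im := (@complex.Im R).

Lemma real_complex_continuous : continuous (real_complex R : R -> C).
Proof.
move=> x; apply/cvgrPdist_lt => e e0.
have [eR eE] : exists r : R, e = r%:C.
  by exists (Re e); apply/esym/RRe_real; rewrite gtr0_real.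
have r0 : 0 < eR by move: e0; rewrite eE ltcR.
near=> y; rewrite -rmorphB /= normc_def /= expr0n addr0 sqrtr_sqr eE ltcR.
by near: y; apply: (@cvgr_dist_lt _ _ _ (nbhs x) _ id).
Unshelve. all: by end_near. Qed.

Lemma line_continuous (z d : C) : continuous (fun t : R => z + t%:C * d).
Proof.
move=> t; apply: cvgD; first exact: cvg_cst.
by apply: cvgM; [exact: real_complex_continuous|exact: cvg_cst].
Qed.

(** The open half-plane Re (conj w * z) < 0 is star-shaped about - w and avoids K, so
    it lies in one component U of the complement of K.  It is unbounded and
    accumulates at 0, while 0 is in K and hence not in U. *)
Lemma half_plane_component (K : set C) (w : C) : w != 0 -> K 0 ->
  (forall z, K z -> 0 <= Re (conjc w * z)) ->
  exists U, is_unbounded_component K U /\ boundary U 0.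
Proof.
move=> w0 K0 Kge0.
have ww : 0 < Re (conjc w * w).
  case: w w0 {Kge0} => x y; rewrite eq_complex/= negb_and => xy.
  have : x ^+ 2 + y ^+ 2 != 0 by rewrite paddr_eq0 ?sqr_ge0// !sqrf_eq0 negb_and.
  rewrite lt_def; have := sqr_ge0 x; have := sqr_ge0 y; nra.
have HK z : Re (conjc w * z) < 0 -> ~ K z.
  by move=> zn /Kge0; rewrite leNgt zn.
have Hw (t : R) : 0 < t -> Re (conjc w * (- (t%:C * w))) < 0.
  move=> t0; rewrite mulrN mulrCA raddfN/= oppr_lt0.
  by case: (conjc w * w) ww => x y /= x0; rewrite mul0r subr0 mulr_gt0.
(* The base point is - w, written as a value of the ray of Hw. *)
pose U := connected_component (~` K) (- (1%:C * w)).
have HU z : Re (conjc w * z) < 0 -> U z.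
  move=> zn.
  pose f (t : R) : C := - (1%:C * w) + t%:C * (z - - (1%:C * w)).
  have : connected (f @` `[0, 1]).
    apply: connected_continuous_connected; first exact: segment_connected.
    by apply: continuous_subspaceT; exact: line_continuous.
  move=> Cf; apply: (connected_component_max _ _ Cf).
  - exists 0; first by rewrite /= in_itv/= lexx ler01.
    by rewrite /f rmorph0 mul0r addr0.
  - move=> y [t /=]; rewrite in_itv/= => /andP[t0 t1] <-; apply: HK.
    have := Hw _ ltr01; rewrite /f.
    set a := - _; move=> an.
    rewrite mulrDr mulrCA mulrBr raddfD/=.
    move: an zn; case: (conjc w * a) => a1 a2 /=; case: (conjc w * z) => b1 b2 /=.
    move=> a10 b10; nra.
  - exists 1; first by rewrite /= in_itv/= lexx ler01.
    by rewrite /f !rmorph1 !mul1r addrC subrK.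
exists U; split.
  exists (- (1%:C * w)); split; [exact: HK (Hw _ ltr01)|by []|].
  have FU : ProperFilter (globally U) by exact: globally_properfilter (HU _ (Hw _ ltr01)).
  move=> /ex_bound[M UM].
  have nw : 0 < `|w| by rewrite normr_gt0.
  have M0 : 0 <= M by apply: le_trans (UM _ (HU _ (Hw _ ltr01))).
  pose t : R := Re (M / `|w|) + 1.
  have tE : t%:C = M / `|w| + 1.
    by rewrite /t rmorphD/= RRe_real// ger0_real// divr_ge0.
  have t0 : 0 < t by rewrite -ltcR tE ltr_pwDr// divr_ge0.
  have /= := UM _ (HU _ (Hw _ t0)); rewrite normrN normrM tE ger0_norm.
    by rewrite mulrDl divfK ?gt_eqF// mul1r gerDl lt_geF.
  by rewrite addr_ge0// divr_ge0.
split; last first.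
  by move=> /interior_subset/connected_component_sub; apply.
move=> B B0.
have : (fun t : R => 0 + t%:C * - w) @ 0 --> (0 + 0%:C * - w : C).
  exact: line_continuous.
rewrite rmorph0 mul0r addr0 => /(_ _ B0)/nbhs_ballP[e/= e0 eB].
exists (- ((e / 2)%:C * w)); split; first by apply: HU; apply: Hw; rewrite divr_gt0.
rewrite -[X in B X]add0r -mulrN; apply: (eB (e / 2)).
rewrite /ball/= sub0r normrN gtr0_norm ?divr_gt0//.
by rewrite ltr_pdivrMr// ltr_pMr// ltr1n.
Qed.

End HalfPlane.

(** * Velocities of complex-valued curves *)

Section Velocity.
Context {R : realType}.
Local Notation C := R[i].
Local Notation Re := (@complex.Re R).
Local Notation Im := (@complex.Im R).

Definition has_velocity (f : R -> C) t z :=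
  is_derive t (1 : R) (Re \o f) (Re z) /\ is_derive t (1 : R) (Im \o f) (Im z).

Lemma has_velocityP f t z : has_velocity f t z -> cderivable f t /\ velocity f t = z.
Proof.
move=> [fRe fIm]; split.
  by split; [exact: (@ex_derive _ _ _ _ _ _ _ fRe)|exact: (@ex_derive _ _ _ _ _ _ _ fIm)].
rewrite /velocity !derive1E.
by rewrite (@derive_val _ _ _ _ _ _ _ fRe) (@derive_val _ _ _ _ _ _ _ fIm); case: z {fRe fIm}.
Qed.

Lemma has_velocity_cst z t : has_velocity (fun=> z) t 0.
Proof. by split; exact: is_derive_cst. Qed.

Lemma has_velocityD f g t z1 z2 : has_velocity f t z1 -> has_velocity g t z2 ->
  has_velocity (fun x => f x + g x) t (z1 + z2).
Proof.
move=> [f1 f2] [g1 g2]; split.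
  rewrite (_ : Re \o _ = (Re \o f) + (Re \o g)); last first.
    by apply/funext => x; rewrite /= raddfD.
  by apply: is_derive_eq; rewrite raddfD.
rewrite (_ : Im \o _ = (Im \o f) + (Im \o g)); last first.
  by apply/funext => x; rewrite /= raddfD.
by apply: is_derive_eq; rewrite raddfD.
Qed.

Lemma has_velocityM f g t z1 z2 : has_velocity f t z1 -> has_velocity g t z2 ->
  has_velocity (fun x => f x * g x) t (z1 * g t + f t * z2).
Proof.
move=> [f1 f2] [g1 g2]; split.
  rewrite (_ : Re \o _ = (Re \o f) * (Re \o g) - (Im \o f) * (Im \o g)); last first.
    by apply/funext => x; rewrite /= !fctE/=; case: (f x) (g x) => ? ? [].
  apply: is_derive_eq; rewrite /= raddfD/= /GRing.scale/=.
  by case: (f t) (g t) z1 z2 {f1 f2 g1 g2} => ? ? [? ?] [? ?] [? ?] /=; ring.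
rewrite (_ : Im \o _ = (Re \o f) * (Im \o g) + (Im \o f) * (Re \o g)); last first.
  by apply/funext => x; rewrite /= !fctE/=; case: (f x) (g x) => ? ? [].
apply: is_derive_eq; rewrite /= raddfD/= /GRing.scale/=.
by case: (f t) (g t) z1 z2 {f1 f2 g1 g2} => ? ? [? ?] [? ?] [? ?] /=; ring.
Qed.

Lemma has_velocity_horner (P : {poly C}) f t z : has_velocity f t z ->
  has_velocity (fun x => P.[f x]) t (P^`().[f t] * z).
Proof.
move=> fz; elim/poly_ind: P => [|P c IH].
  rewrite deriv0 horner0 mul0r (_ : (fun _ => _) = (fun=> 0)).
    exact: has_velocity_cst.
  by apply/funext => x; rewrite horner0.
rewrite (_ : (fun _ => _) = (fun x => P.[f x] * f x + c)); last first.
  by apply/funext => x; rewrite hornerMXaddC.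
rewrite (_ : _ * z = P^`().[f t] * z * f t + P.[f t] * z + 0).
  exact: has_velocityD (has_velocityM IH fz) (has_velocity_cst c t).
by rewrite derivMXaddC !hornerE; ring.
Qed.

Lemma Re_graph (y : {poly R}) a l :
  Re \o (fun t => graph y (a + l * t)) = horner (a%:P + l *: 'X).
Proof. by apply/funext => t; rewrite /= !hornerE. Qed.

Lemma Im_graph (y : {poly R}) a l :
  Im \o (fun t => graph y (a + l * t)) = horner (y \Po (a%:P + l *: 'X)).
Proof. by apply/funext => t; rewrite /= horner_comp !hornerE. Qed.

Lemma has_velocity_graph y a l t :
  has_velocity (fun t => graph y (a + l * t)) t (l%:C * (1 +i* y^`().[a + l * t])).
Proof.
have dl : deriv (a%:P + l *: 'X) = l%:P.
  by rewrite poly.derivD poly.derivC poly.derivZ poly.derivX add0r alg_polyC.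
split; rewrite ?Re_graph ?Im_graph.
  by apply: is_derive_eq; rewrite dl hornerC /= mulr1 mul0r subr0.
apply: is_derive_eq.
by rewrite deriv_comp dl hornerM hornerC horner_comp !hornerE /=; ring.
Qed.

Lemma derivable_horner_derive1n (p : {poly R}) k t : derivable (horner p)^`(k) t 1.
Proof.
rewrite (_ : _^`(k) = horner p^`(k)); first exact: derivable_horner.
elim: k p => [|k IH] p; first by [].
by rewrite derive1Sn -derivE IH derivSn.
Qed.

Lemma smooth_graph (y : {poly R}) a l t : smooth_at (fun t => graph y (a + l * t)) t.
Proof.
move=> k.
rewrite Re_graph Im_graph.
by split; exact: derivable_horner_derive1n.
Qed.

End Velocity.

(** * Perturbing the segment inside the half-plane *)

(** The bound M on the values is carried along for the product p * 'X in the
    induction. *)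
Lemma horner_lipschitz (K : numDomainType) (p : {poly K}) (B : K) : 0 <= B ->
  exists M L, [/\ 0 <= M, 0 <= L, forall z, `|z| <= B -> `|p.[z]| <= M &
    forall z h, `|z| <= B -> `|h| <= 1 -> `|p.[z + h] - p.[z]| <= L * `|h|].
Proof.
move=> B0; elim/poly_ind: p => [|p c [M [L [M0 L0 pM pL]]]].
  exists 0, 0; split => // [z _|z h _ _]; by rewrite !horner0 ?subrr normr0 ?mul0r.
exists (M * B + `|c|), (L * (B + 1) + M); split.
- by rewrite addr_ge0 ?mulr_ge0.
- by rewrite addr_ge0 ?mulr_ge0 ?addr_ge0.
- move=> z zB; rewrite hornerMXaddC (le_trans (ler_normD _ _))// lerD2r normrM.
  by rewrite ler_pM ?normr_ge0 ?pM.
- move=> z h zB h1; rewrite !hornerMXaddC.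
  rewrite (_ : _ - _ = (p.[z + h] - p.[z]) * (z + h) + p.[z] * h); last by ring.
  rewrite (le_trans (ler_normD _ _))// [leRHS]mulrDl !normrM lerD//; last first.
    by rewrite ler_wpM2r ?pM.
  rewrite mulrAC ler_pM ?normr_ge0 ?pL//.
  by rewrite (le_trans (ler_normD _ _))// lerD.
Qed.

Section Perturbation.
Context {R : realType}.
Local Notation C := R[i].
Local Notation Re := (@complex.Re R).
Local Notation Im := (@complex.Im R).

Lemma normc_real (x : R) : `|x%:C| = `|x|%:C.
Proof. by rewrite normc_def/= expr0n addr0 sqrtr_sqr. Qed.

Lemma normc_imag (x : R) : `|0 +i* x| = `|x|%:C.
Proof. by rewrite normc_def/= expr0n add0r sqrtr_sqr. Qed.

Lemma normc_conj (z : C) : `|conjc z| = `|z|.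
Proof. by case: z => x y; rewrite !normc_def /= sqrrN. Qed.

Lemma Re_gt0_of_close (z z' : C) (d : R) : `|z' - z| <= d%:C -> d < Re z -> 0 < Re z'.
Proof.
move=> H dz; have := le_trans (normc_ge_Re (z' - z)) H.
rewrite lecR raddfB/= ler_norml => /andP[H1 _]; lra.
Qed.

(** For P = (X - a)(b - X) Q, m(x) = (x - a)(b - x) and z = x + i m(x) k, one has
    (z - a)(b - z) = m(x) D, where D is the product of the first two factors in the
    conclusion; so D Q(z) is P(z) divided by m(x), which vanishes at the ends.  Since D - 1 and
    Q(z) - Q(x) are O(k) uniformly on [a, b], the real part stays positive. *)
Lemma small_perturbation (Q : {poly C}) (w : C) (a b mu : R) :
  0 <= a -> a <= b -> 0 < mu ->
  (forall x, a <= x <= b -> mu <= Re (conjc w * Q.[x%:C])) ->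
  exists2 d : R, 0 < d & forall x k, a <= x <= b -> `|k| <= d ->
    0 < Re (conjc w * ((1 +i* ((b - x) * k)) * (1 -i* ((x - a) * k)) *
            Q.[x +i* ((x - a) * (b - x) * k)])).
Proof.
move=> a0 ab mu0 Qmu.
have b0 : 0 <= b by apply: le_trans ab.
have bC : 0 <= b%:C :> C by rewrite lecR.
have [M [L [M0 L0 QM QL]]] := horner_lipschitz Q bC.
pose l := b - a; have l0 : 0 <= l by rewrite subr_ge0.
pose e : R := l + l ^+ 2; have e0 : 0 <= e by rewrite addr_ge0 ?sqr_ge0.
(* The real part moves by at most c |k|. *)
pose c : R := Re `|w| * (Re L * l ^+ 2 * (1 + e) + Re M * e).
have ME : M = (Re M)%:C by rewrite RRe_real// ger0_real.
have LE : L = (Re L)%:C by rewrite RRe_real// ger0_real.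
have wE : `|w| = (Re `|w|)%:C by rewrite RRe_real// ger0_real.
have RM0 : 0 <= Re M by rewrite -lecR -ME.
have RL0 : 0 <= Re L by rewrite -lecR -LE.
have Rw0 : 0 <= Re `|w| by rewrite -lecR -wE normr_ge0.
have c0 : 0 <= c.
  have e1 : 0 <= 1 + e by rewrite addr_ge0.
  exact: mulr_ge0 Rw0 (addr_ge0 (mulr_ge0 (mulr_ge0 RL0 (sqr_ge0 _)) e1) (mulr_ge0 RM0 e0)).
pose l2 := 1 + l ^+ 2; have l20 : 0 < l2 by rewrite ltr_wpDr// sqr_ge0.
(* The first bound ensures |m(x) k| <= 1 and |k| <= 1, the second c |k| < mu. *)
pose d := Num.min (l2^-1) (mu / (c + 1) / 2).
have c1 : 0 < c + 1 by lra.
exists d; first by rewrite lt_min invr_gt0 l20 !divr_gt0.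
move=> x k /[dup] xab /andP[ax xb] kd.
have kl2 : `|k| * l2 <= 1.
  by rewrite -ler_pdivlMr// div1r (le_trans kd)// ge_min lexx.
have k1 : `|k| <= 1.
  by apply: le_trans kl2; rewrite ler_peMr// lerDl sqr_ge0.
have kc : c * `|k| < mu.
  have : `|k| <= mu / (c + 1) / 2 by rewrite (le_trans kd)// ge_min lexx orbT.
  rewrite ler_pdivlMr// ler_pdivlMr// => H; have := normr_ge0 k; nra.
apply: (@Re_gt0_of_close (conjc w * Q.[x%:C]) _ (c * `|k|)); last first.
  exact: lt_le_trans kc (Qmu x xab).
set D := _ * (1 -i* _); set z := x +i* _.
have m0 : 0 <= (x - a) * (b - x) by rewrite mulr_ge0 ?subr_ge0.
have ml : (x - a) * (b - x) <= l ^+ 2 by rewrite /l; nra.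
have zE : z = x%:C + (0 +i* ((x - a) * (b - x) * k)) by rewrite /z; simpc.
clearbody z.
have nx : `|x%:C| <= b%:C :> C by rewrite normc_real lecR ger0_norm// (le_trans a0).
have nh : `|0 +i* ((x - a) * (b - x) * k)| <= (l ^+ 2 * `|k|)%:C.
  by rewrite normc_imag lecR normrM ger0_norm// ler_wpM2r.
have nh1 : `|0 +i* ((x - a) * (b - x) * k)| <= 1.
  by apply: le_trans nh _; rewrite lecR; apply: le_trans kl2; rewrite mulrC ler_wpM2l// lerDr.
have nQ : `|Q.[z] - Q.[x%:C]| <= (Re L * l ^+ 2 * `|k|)%:C.
  have -> : (Re L * l ^+ 2 * `|k|)%:C = L * (l ^+ 2 * `|k|)%:C.
    by rewrite [in RHS]LE -rmorphM /= -!mulrA.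
  by rewrite zE (le_trans (QL _ _ nx nh1))// ler_wpM2l.
have DE : D - 1 = 0 +i* (((b - x) - (x - a)) * k) + ((x - a) * (b - x) * k * k)%:C.
  by rewrite /D; simpc; congr (_ +i* _); ring.
clearbody D.
have nD : `|D - 1| <= (e * `|k|)%:C.
  rewrite DE (le_trans (ler_normD _ _))// normc_imag normc_real -rmorphD lecR/=.
  rewrite /e [leRHS]mulrDl lerD//.
    by rewrite normrM ler_wpM2r// ler_norml /l; apply/andP; split; lra.
  rewrite !normrM (ger0_norm _ : `|x - a| = x - a) ?subr_ge0//.
  rewrite (ger0_norm _ : `|b - x| = b - x) ?subr_ge0//.
  by rewrite -[leLHS]mulrA; apply: ler_pM => //; exact: ler_piMl.
have nD1 : `|D| <= (1 + e)%:C.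
  rewrite -[D](subrK 1) (le_trans (ler_normD _ _))// normr1 addrC rmorphD lerD2l.
  by rewrite (le_trans nD)// lecR ler_piMr.
rewrite -mulrBr normrM.
have -> : `|conjc w| = (Re `|w|)%:C by rewrite -wE normc_conj.
have -> : (c * `|k|)%:C = (Re `|w|)%:C *
    ((Re L * l ^+ 2 * `|k|)%:C * (1 + e)%:C + (Re M)%:C * (e * `|k|)%:C).
  rewrite -!rmorphM -rmorphD -rmorphM; apply: (congr1 (real_complex R)).
  by rewrite /c; ring.
rewrite -ME ler_wpM2l ?lecR//.
rewrite (_ : D * Q.[z] - Q.[x%:C] = (Q.[z] - Q.[x%:C]) * D + Q.[x%:C] * (D - 1)); last by ring.
rewrite (le_trans (ler_normD _ _))// !normrM.
by apply: lerD; apply: ler_pM => //; exact: QM.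
Qed.

End Perturbation.

(** * A generic graph and the conclusion *)

Section Assembly.
Context {R : realType}.
Local Notation C := R[i].
Local Notation Re := (@complex.Re R).
Local Notation Im := (@complex.Im R).

Lemma deriv_neq0 (P : {poly C}) : (1 < size P)%N -> deriv P != 0.
Proof.
move=> P1; apply/eqP => /(congr1 (fun p : {poly C} => p`_(size P).-2)).
rewrite coef_deriv coef0 => /eqP; rewrite mulrn_eq0/=.
have -> : (size P).-2.+1 = (size P).-1 by case: (size P) P1 => [|[]].
by rewrite -lead_coefE lead_coef_eq0 -size_poly_eq0; case: (size P) P1.
Qed.

Lemma transversal_scale (l : R) (A B A' B' : C) : l != 0 ->
  transversal (A * (l%:C * B)) (A' * (l%:C * B')) = transversal (A * B) (A' * B').
Proof.
move=> l0; rewrite /transversal.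
rewrite (mulrCA A) (mulrCA A'); move: (A * B) (A' * B') => [x y] [x' y'] /=.
rewrite !mul0r !subr0 !addr0 mulrACA [X in _ != X]mulrACA.
by congr (~~ _); apply/eqP/eqP => [|->//]; apply/mulfI; rewrite mulf_neq0.
Qed.

(** The graph passes through a point z only if m(Re z) k(Re z) = Im z.  When
    m(Re z) <> 0 this is a nontrivial affine equation in c0, whatever the other
    coefficients are; g is the product of these equations over the roots z of
    P. *)
Lemma critical_avoidance (P : {poly C}) (m : {poly R}) : P != 0 ->
  exists g : C -> C -> C -> {poly C}, (forall x y z, g x y z != 0) /\
    forall c0 c1 c2 c3 x, (g c1%:C c2%:C c3%:C).[c0%:C] != 0 -> m.[x] != 0 ->
      P.[graph (m * cubic c0 c1 c2 c3) x] != 0.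
Proof.
move=> P0; have [rs Prs] := closed_field_poly_normal P.
pose factor (c1 c2 c3 z : C) : {poly C} :=
  (m.[Re z])%:C *: 'X + ((m.[Re z])%:C * (c1 * (Re z)%:C + c2 * (Re z)%:C ^+ 2 +
    c3 * (Re z)%:C ^+ 3) - (Im z)%:C)%:P.
exists (fun c1 c2 c3 => \prod_(z <- rs | m.[Re z] != 0) factor c1 c2 c3 z); split.
  move=> x y z; rewrite prodf_seq_neq0; apply/allP => r _; apply/implyP => mr.
  apply/eqP => /(congr1 (fun p : {poly C} => p`_1)).
  rewrite coefD coefZ coefX coefC coef0 /= mulr1 addr0 => /eqP.
  by rewrite fmorph_eq0; apply/negP.
move=> c0 c1 c2 c3 x; set y := m * _ => gn mx; apply: contra gn => Pz.
have zrs : graph y x \in rs.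
  move: Pz; rewrite Prs hornerZ mulf_eq0 lead_coef_eq0 (negPf P0)/=.
  by rewrite -[_ == 0]/(root _ _) root_prod_XsubC.
rewrite horner_prod prodf_seq_eq0; apply/hasP; exists (graph y x) => //=; rewrite mx /=.
have yE : y.[x] = m.[x] * (c0 + c1 * x + c2 * x ^+ 2 + c3 * x ^+ 3).
  by rewrite /y hornerM horner_cubic.
clearbody y.
rewrite (_ : _.[_] = (m.[x] * (c0 + c1 * x + c2 * x ^+ 2 + c3 * x ^+ 3) - y.[x])%:C).
  by rewrite fmorph_eq0 yE subrr.
by rewrite /factor !hornerE /= rmorphB !rmorphM !rmorphD !rmorphM /=; ring.
Qed.

(** A point of ]0, e]^4 which violates the relation of [tangent_crossing_relation]
    exists because a nonzero polynomial does not vanish on the fourth power of the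
    infinite set of all e / (n + 1); avoiding in addition the critical points of P
    lets the failure of transversality count as a tangential self-intersection. *)
Lemma generic_graph (P : {poly C}) (m : {poly R}) (e : R) :
  (1 < size P)%N -> 0 < e ->
  exists c0 c1 c2 c3, [/\ 0 < c0 <= e, 0 < c1 <= e, 0 < c2 <= e, 0 < c3 <= e &
    forall x x', m.[x] != 0 -> m.[x'] != 0 -> x != x' ->
      let y := m * cubic c0 c1 c2 c3 in
      P.[graph y x] = P.[graph y x'] ->
      transversal (P^`().[graph y x] * (1 +i* y^`().[x]))
                  (P^`().[graph y x'] * (1 +i* y^`().[x']))].
Proof.
move=> P1 e0.
have [N [q [q0 rel]]] := tangent_crossing_relation m P1.
have [g [g0 gP]] := critical_avoidance m (deriv_neq0 P1).
pose s n : R := e / n.+1%:R.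
have sP n : 0 < s n <= e.
  by rewrite divr_gt0//= ler_pdivrMr// ler_peMr ?ler1n ?ltW.
have s_inj : injective (fun n => (s n)%:C).
  move=> n1 n2 /complexI /(mulfI (lt0r_neq0 e0)) /invr_inj /eqP.
  by rewrite eqr_nat => /eqP[].
have [n0 [n1 [n2 [n3 [gn qn]]]]] := select_parameters s_inj g0 q0.
exists (s n0), (s n1), (s n2), (s n3); split => // x x' mx mx' xx' y Pxx'.
apply: contraNT qn => ntr; apply/eqP/(rel _ _ _ _ x x') => //.
by split => //; apply: gP.
Qed.

Lemma cubic_bound (c0 c1 c2 c3 e b x : R) :
  0 < c0 <= e -> 0 < c1 <= e -> 0 < c2 <= e -> 0 < c3 <= e -> 0 <= x <= b ->
  `|(cubic c0 c1 c2 c3).[x]| <= e * (1 + b + b ^+ 2 + b ^+ 3).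
Proof.
move=> /andP[c00 c0e] /andP[c10 c1e] /andP[c20 c2e] /andP[c30 c3e] /andP[x0 xb].
have b0 : 0 <= b by apply: le_trans xb.
rewrite horner_cubic ger0_norm; last first.
  by rewrite !addr_ge0 ?mulr_ge0 ?exprn_ge0// ltW.
by rewrite !mulrDr mulr1 !lerD// ler_pM ?exprn_ge0 ?lerXn2r ?nnegrE// ltW.
Qed.

Lemma Re_horner_ge (n : nat) (coef : 'I_n.+1 -> C) (w : C) (x : R) :
  (forall k, 0 < Re (conjc w * coef k)) -> 0 <= x ->
  Re (conjc w * coef ord0) <=
  Re (conjc w * (\sum_(k < n.+1) coef k *: 'X^k : {poly C}).[x%:C]).
Proof.
move=> wc x0; rewrite horner_sum mulr_sumr raddf_sum/= big_ord_recl/=.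
have E k : Re (conjc w * (coef k *: 'X^k : {poly C}).[x%:C]) = Re (conjc w * coef k) * x ^+ k.
  rewrite hornerZ hornerXn mulrA -rmorphXn.
  by case: (conjc w * coef k) => p q /=; rewrite mulr0 subr0.
rewrite E expr0 mulr1 lerDl sumr_ge0// => k _.
by rewrite E mulr_ge0 ?exprn_ge0// ltW.
Qed.

End Assembly.

Theorem corollary5p8 (R : realType) (a b : R) (n : nat)
    (coef : 'I_n.+1 -> R[i]) :
  0 <= a -> a < b ->
  ~ convex_hull coef 0 ->
  let P1 : {poly R[i]} := \sum_(k < n.+1) coef k *: 'X^k in
  let P : {poly R[i]} := ('X - (a%:C)%:P) * ((b%:C)%:P - 'X) * P1 in
  property_E P a%:C b%:C 0.
Proof.
move=> a0 ab /convex_hull_separation[w wcoef] P1 P.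
have ab' := ltW ab.
have [d d0 dP] := small_perturbation a0 ab' (wcoef ord0)
  (fun x xab => Re_horner_ge wcoef (le_trans a0 (andP xab).1)).
have Pa : P.[a%:C] = 0 by rewrite /P !hornerM !hornerE subrr !mul0r.
have Pb : P.[b%:C] = 0 by rewrite /P !hornerM !hornerE subrr mulr0 mul0r.
have P1b : P1.[b%:C] != 0.
  have := Re_horner_ge wcoef (le_trans a0 ab').
  apply: contraTneq => ->; rewrite mulr0 /= -ltNge; exact: wcoef.
have P_neq0 : P != 0.
  rewrite /P !mulf_neq0 ?polyXsubC_eq0//.
    by rewrite -opprB oppr_eq0 polyXsubC_eq0.
  by apply: contraNneq P1b => ->; rewrite horner0.
have P_gt1 : (1 < size P)%N by apply: root_size_gt1 P_neq0 _; apply/eqP/Pa.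
pose m : {poly R} := ('X - a%:P) * (b%:P - 'X).
have mE x : m.[x] = (x - a) * (b - x) by rewrite /m hornerM !hornerE.
(* On [a, b], which lies in [0, b], coefficients in ]0, e] give |k| <= e B. *)
pose B := 1 + b + b ^+ 2 + b ^+ 3.
have B0 : 0 < B by rewrite !ltr_wpDr ?exprn_ge0 ?(le_trans a0).
have [c0 [c1 [c2 [c3 [c0e c1e c2e c3e tr]]]]] :=
  generic_graph m P_gt1 (divr_gt0 d0 B0).
pose k := cubic c0 c1 c2 c3; pose y := m * k.
pose l := b - a; have l0 : 0 < l by rewrite subr_gt0.
pose Gamma t : R[i] := graph y (a + l * t).
have kd x : a <= x <= b -> `|k.[x]| <= d.
  move=> /andP[ax xb]; rewrite -[d](divfK (lt0r_neq0 B0)).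
  by apply: cubic_bound => //; rewrite (le_trans a0 ax).
have Pgraph x : P.[graph y x] = (m.[x])%:C *
   ((1 +i* ((b - x) * k.[x])) * (1 -i* ((x - a) * k.[x])) *
            P1.[x +i* ((x - a) * (b - x) * k.[x])]).
  rewrite /P /graph /y hornerM mE hornerM mulrA; congr (_ * _); last first.
    by rewrite hornerM mE.
  by rewrite !hornerM !hornerE; simpc; congr (_ +i* _); ring.
have Re_pos x : a < x < b -> 0 < complex.Re (conjc w * P.[graph y x]).
  move=> /andP[ax xb]; rewrite Pgraph mulrCA.
  have xab : a <= x <= b by rewrite !ltW.
  have := dP x _ xab (kd x xab); rewrite -/P1.
  case: (conjc w * _) => p q /= p0; rewrite mul0r subr0 mulr_gt0// mE.
  by rewrite mulr_gt0 ?subr_gt0.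
have inab t : 0 < t -> t < 1 -> a < a + l * t < b.
  move=> t0 t1; rewrite ltrDl mulr_gt0//= /l; nra.
have G0 : Gamma 0 = a%:C.
  by rewrite /Gamma /graph mulr0 addr0 /y hornerM mE subrr !mul0r.
have G1 : Gamma 1 = b%:C.
  by rewrite /Gamma /graph mulr1 addrC subrK /y hornerM mE subrr mulr0 mul0r.
split => //; split => //; exists Gamma; split.
- split => //.
  exists [:: 1]; first by split => //=; rewrite ltr01.
  case=> [_|//] /=.
  exists Gamma; exists 1 => //; split => //.
    by move=> t _; exact: smooth_graph.
  move=> t _; have [_ ->] := has_velocityP (has_velocity_graph y a l t).
  apply: mulf_neq0; first by rewrite fmorph_eq0 gt_eqF.
  by rewrite eq_complex /= oner_eq0.
- move=> s t s0 st t1 gst.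
  have t0 := lt_trans s0 st; have s1 := lt_trans st t1.
  have [cs ->] := has_velocityP (has_velocity_horner P (has_velocity_graph y a l s)).
  have [ct ->] := has_velocityP (has_velocity_horner P (has_velocity_graph y a l t)).
  split => //; rewrite transversal_scale ?gt_eqF//.
  have m0 u : 0 < u -> u < 1 -> m.[a + l * u] != 0.
    move=> u0 u1; have /andP[au ub] := inab u u0 u1.
    by rewrite mE mulf_neq0// gt_eqF// subr_gt0.
  apply: tr; rewrite ?m0//.
  by rewrite (inj_eq (addrI a)) (inj_eq (mulfI (lt0r_neq0 l0))) lt_eqF.
- move=> t; rewrite inE /= in_itv/= !le_eqVlt => /andP[/orP[/eqP<-|t0]]; first by left.
  move=> /orP[/eqP->|t1]; first by right.
  move=> gt0; have := Re_pos _ (inab t t0 t1).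
  by rewrite -/(Gamma t) gt0 mulr0 ltxx.
- apply: (@half_plane_component R _ w).
  + by apply/eqP => w0; have := wcoef ord0; rewrite w0 rmorph0 mul0r ltxx.
  + exists 0; first by rewrite /= in_itv/= lexx ler01.
    by rewrite G0.
  + move=> _ [t /= + <-]; rewrite in_itv/= => /andP[].
    rewrite le_eqVlt => /orP[/eqP<- _|t0]; first by rewrite G0 Pa mulr0.
    rewrite le_eqVlt => /orP[/eqP->|t1]; first by rewrite G1 Pb mulr0.
    exact/ltW/Re_pos/inab.
Qed.
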